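(* Let $a_k(x)=\sum_{m=0}^k\binom{2k+2-m}{k-m}x^m$ for $k\ge 0$, let $n\ge 0$ be an integer, and let $H_0=H_0(n,x)=\det[a_{i+j}(x)]_{0\le i,j\le n}$. Then $$S_2\frac{d^2}{dx^2}H_0+S_1\frac{d}{dx}H_0+S_0H_0=0,$$ where $$S_2=(x-2)(x+2)(4n^2x^2+4nx^2+x^2+8nx+4),$$ $$S_1=2(4n^2x^3+4nx^3+x^3-4n^2x^2+8nx^2-x^2+16n^2x+8nx+12x+16n-4),$$ $$S_0=-n(n+1)(4n^2x^2+4nx^2+x^2+8nx-8x+36).$$
   Context: The determinant $H_0(n,x)$ is that of the $(n+1)\times(n+1)$ Hankel matrix with $(i,j)$ entry $a_{i+j}(x)$, $0\le i,j\le n$; it is a polynomial in $x$. The subscript $0$ in $H_0$ is a label only and does not refer to the size of the matrix. *)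

(* Defs.v *)
From mathcomp Require Import all_boot all_order all_algebra.

Set Implicit Arguments.
Unset Strict Implicit.
Unset Printing Implicit Defensive.

Import GRing.Theory.
Local Open Scope ring_scope.

(* The entries have integer coefficients; they are taken in Q[x], so that d/dx
   is the formal derivative of {poly rat}. The truncated subtractions on nat
   are exact since m <= k. *)
Definition hankel_entry (k : nat) : {poly rat} :=
  \sum_(m < k.+1) 'C((2 * k + 2 - m)%N, (k - m)%N)%:R * 'X^m.

Definition hankel_mx (n : nat) : 'M[{poly rat}]_n.+1 :=
  \matrix_(i, j) hankel_entry (i + j)%N.

Definition H0 (n : nat) : {poly rat} := \det (hankel_mx n).

(* In the coefficients below, n stands for the constant polynomial n%:R. *)
Definition S2 (m : nat) : {poly rat} :=
  let n : {poly rat} := m%:R in let x : {poly rat} := 'X in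
  (x - 2) * (x + 2)
  * (4 * n ^+ 2 * x ^+ 2 + 4 * n * x ^+ 2 + x ^+ 2 + 8 * n * x + 4).

Definition S1 (m : nat) : {poly rat} :=
  let n : {poly rat} := m%:R in let x : {poly rat} := 'X in
  2 * (4 * n ^+ 2 * x ^+ 3 + 4 * n * x ^+ 3 + x ^+ 3 - 4 * n ^+ 2 * x ^+ 2
       + 8 * n * x ^+ 2 - x ^+ 2 + 16 * n ^+ 2 * x + 8 * n * x + 12 * x
       + 16 * n - 4).

Definition S0 (m : nat) : {poly rat} :=
  let n : {poly rat} := m%:R in let x : {poly rat} := 'X in
  - n * (n + 1)
  * (4 * n ^+ 2 * x ^+ 2 + 4 * n * x ^+ 2 + x ^+ 2 + 8 * n * x - 8 * x + 36).

(* Main.v *)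
Require Import Defs.
From mathcomp Require Import all_boot all_order all_algebra.
From mathcomp Require Import zify ring.

Import GRing.Theory.
Local Open Scope ring_scope.

(* With t = u / (1 + u)^2, i.e. 1/t = u + 2 + 1/u, the number a_k is the
   constant term of (u + 2 + 1/u)^k (1 + u)^3 / (1 - (x - 1) u).  In the basis
   (u^(i+1/2) + u^(-i-1/2)) / (u^(1/2) + u^(-1/2)) of polynomials in 1/t the
   Gram matrix of this functional is the Toeplitz-plus-Hankel matrix
   v_|i-j| + v_(i+j+1), where v_m is the coefficient of u^m in
   u (1 + u) / (1 - (x - 1) u).  As v is geometric, subtracting x - 1 times the
   previous row and column leaves a pentadiagonal matrix whose bulk symbol is
   (y + 2) (y - x), y = u + 1/u.  The solutions of its five-term recurrence are
   combinations of (-1)^j, j (-1)^j and Chebyshev polynomials, so Cramer's rule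
   gives, with U_k the Chebyshev polynomial in x/2,
     (x + 2) H_0(n) =
       (-1)^n [((2n+1) x + 2) U_n + ((2n+3) x + 2) U_(n-1)].
   The differential equation follows by eliminating the derivatives of U_n and
   U_(n-1), which (x^2 - 4) d/dx maps to combinations of U_n and U_(n-1). *)

(** * Chebyshev polynomials *)

(* cheb x n is U_(n-2)(x/2), extended backwards by U_(-2) = -1. *)
Fixpoint cheb {R : comNzRingType} (x : R) (n : nat) : R :=
  match n with
  | 0 => -1
  | 1 => 0
  | (m.+1 as p).+1 => x * cheb x p - cheb x m
  end.

Lemma chebSS {R : comNzRingType} (x : R) n :
  cheb x n.+2 = x * cheb x n.+1 - cheb x n.
Proof. by []. Qed.

Definition chebG {R : comNzRingType} (x : R) (n : nat) : R :=
  ((2 * n%:R + 1) * x + 2) * cheb x n.+2 + ((2 * n%:R + 3) * x + 2) * cheb x n.+1.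

(** * Hankel entries through the Toeplitz-plus-Hankel Gram matrix *)

Definition geo_coef {R : comNzRingType} (x : R) (m : nat) : R :=
  match m with 0 => 0 | 1 => 1 | p.+2 => x * (x - 1) ^+ p end.

(* (k - l) + (l - k) is |k - l|. *)
Definition toephank {R : comNzRingType} (v : nat -> R) (k l : nat) : R :=
  v ((k - l) + (l - k))%N + v (k + l).+1.

(** For [N = 2 i + 1] the binomials are the coordinates of (u + 2 + 1/u)^i in the symmetric basis,
    so this evaluates at that power the linear functional with values [f] on the basis. *)
Definition binsum {R : comNzRingType} (N i : nat) (f : nat -> R) : R :=
  \sum_(m < i.+1) 'C(N, m)%:R * f (i - m)%N.

Lemma binsum_pascal {R : comNzRingType} N i (f : nat -> R) :
  binsum N.+1 i.+1 f = binsum N i.+1 f + binsum N i f.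
Proof.
rewrite /binsum [LHS]big_ord_recl [X in _ = X + _]big_ord_recl !bin0 -addrA.
congr (_ + _); rewrite -big_split /=; apply: eq_bigr => m _.
by rewrite /bump /= binS natrD mulrDl subSS.
Qed.

(* At k = 0 the truncated predecessor implements the reflection f(-1) = f(0). *)
Definition refl_lap {R : comNzRingType} (f : nat -> R) (k : nat) : R :=
  f k.+1 + 2 * f k + f k.-1.

(** [refl_lap] is the transpose of multiplication by u + 2 + 1/u, which raises the power from i to i
    + 1. *)
Lemma binsum_lap {R : comNzRingType} i (f : nat -> R) :
  binsum (2 * i.+1).+1 i.+1 f = binsum (2 * i).+1 i (refl_lap f).
Proof.
have -> : (2 * i.+1).+1 = (2 * i).+3 by lia.
(* After Pascal's rule twice, the boundary terms at [f 0] in [up] and [dn] cancel; the one in [up]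
   uses C(2i+1, i+1) = C(2i+1, i). *)
have up : binsum (2 * i).+1 i.+1 f =
    binsum (2 * i).+1 i (fun k => f k.+1) + 'C((2 * i).+1, i)%:R * f 0%N.
  rewrite /binsum big_ord_recr /= subnn; congr (_ + _); last first.
    by rewrite -[in LHS]bin_sub; [congr ('C(_, _)%:R * _); lia | lia].
  by apply: eq_bigr => m _; rewrite subSn // -ltnS.
have dn : binsum (2 * i).+2 i f + 'C((2 * i).+1, i)%:R * f 0%N =
    binsum (2 * i).+1 i f + binsum (2 * i).+1 i (fun k => f k.-1).
  case: i {up} => [|i]; first by rewrite /binsum !big_ord_recl !big_ord0 /= !bin0; ring.
  rewrite binsum_pascal -addrA; congr (_ + _).
  rewrite /binsum [RHS]big_ord_recr /= subnn; congr (_ + _).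
  by apply: eq_bigr => m _; rewrite subSn // -ltnS.
rewrite 2!binsum_pascal up.
have -> : binsum (2 * i).+1 i (refl_lap f) = binsum (2 * i).+1 i (fun k => f k.+1)
   + 2 * binsum (2 * i).+1 i f + binsum (2 * i).+1 i (fun k => f k.-1).
  rewrite /binsum mulr_sumr -!big_split /=; apply: eq_bigr => m _.
  by rewrite /refl_lap; ring.
rewrite (canRL (addrK _) dn); ring.
Qed.

(** Multiplication by u + 2 + 1/u is self-adjoint for the Gram form. This lets powers move from the
    row index to the column index. *)
Lemma toephank_lap {R : comNzRingType} (v : nat -> R) k l :
  refl_lap (fun k => toephank v k l) k = refl_lap (toephank v k) l.
Proof.
rewrite /refl_lap /toephank.
by case: k l => [|k] [|l] /=; rewrite !(sub0n, subn0, add0n, addn0, subSS, addSn, addnS); ring.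
Qed.

Lemma eq_binsum {R : comNzRingType} N i (f g : nat -> R) :
  f =1 g -> binsum N i f = binsum N i g.
Proof. by move=> fg; apply: eq_bigr => m _; rewrite fg. Qed.

Lemma binsum_toephank_shift {R : comNzRingType} (v : nat -> R) i j :
  binsum (2 * i.+1).+1 i.+1 (fun k => binsum (2 * j).+1 j (toephank v k)) =
  binsum (2 * i).+1 i (fun k => binsum (2 * j.+1).+1 j.+1 (toephank v k)).
Proof.
rewrite binsum_lap; apply: eq_binsum => k; rewrite binsum_lap.
rewrite -(eq_binsum _ _ _ _ (toephank_lap v k)) /refl_lap /binsum mulr_sumr -!big_split /=.
by apply: eq_bigr => l _; ring.
Qed.

Lemma binsum_toephank {R : comNzRingType} (v : nat -> R) i j :
  binsum (2 * i).+1 i (fun k => binsum (2 * j).+1 j (toephank v k)) =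
  binsum (2 * (i + j)).+1 (i + j) (toephank v 0).
Proof.
elim: i j => [|i IHi] j; first by rewrite [LHS]big_ord1 bin0 mul1r.
by rewrite binsum_toephank_shift IHi addnS.
Qed.

(** Multiplying the generating function by 1 - (x - 1) u leaves the numerator u + u^2. *)
Lemma geo_coef_rec {R : comNzRingType} (x : R) m :
  geo_coef x m.+1 - (x - 1) * geo_coef x m = (m < 2)%:R.
Proof. by case: m => [|[|m]] /=; rewrite ?exprS; ring. Qed.

Lemma toephank_geo_coef0_rec {R : comNzRingType} (x : R) l :
  toephank (geo_coef x) 0 l.+1 - (x - 1) * toephank (geo_coef x) 0 l = (l < 2)%:R + (l < 1)%:R.
Proof.
have e1 := geo_coef_rec x l; have e2 := geo_coef_rec x l.+1; rewrite ltnS in e2.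
rewrite -e1 -e2 /toephank !sub0n !add0n !subn0; ring.
Qed.

(** For fixed [N] both sides start at 1 and satisfy s_(j+1) = (x - 1) s_j + C(N+2, j+1). *)
Lemma binsum_geo_coef {R : comNzRingType} (x : R) N j : (j <= N.+1)%N ->
  binsum N j (toephank (geo_coef x) 0) = \sum_(m < j.+1) 'C((N.+1 - m)%N, (j - m)%N)%:R * x ^+ m.
Proof.
elim: j => [|j IHj] lejN.
  by rewrite /binsum !big_ord1 !bin0 /toephank /= ?subn0; ring.
have lhs : binsum N j.+1 (toephank (geo_coef x) 0) =
    (x - 1) * binsum N j (toephank (geo_coef x) 0) + 'C(N.+2, j.+1)%:R.
  have e l : toephank (geo_coef x) 0 l.+1 =
      (x - 1) * toephank (geo_coef x) 0 l + ((l < 2)%:R + (l < 1)%:R).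
    by rewrite -(toephank_geo_coef0_rec x); ring.
  rewrite /binsum big_ord_recr /= subnn.
  under eq_bigr => m _ do
    rewrite (subSn (ltn_ord m : (m <= j)%N)) e mulrDr mulrCA.
  rewrite big_split /= -mulr_sumr -addrA; congr (_ + _).
  (* Only the arguments 0 and 1 contribute a defect, and C(N, j+1) + 2 C(N, j) + C(N, j-1) = C(N+2,
     j+1). *)
  case: j {IHj} lejN => [|j] _.
    by rewrite big_ord1 /= !bin0 /toephank /= !bin1 !mulrS; ring.
  rewrite 2!big_ord_recr /= big1 => [|m _]; last first.
    have : (1 < j.+1 - m)%N by rewrite ltn_subRL addn1 ltnS.
    by case: (_ - _)%N => [|[|d]] //= _; rewrite addr0 mulr0.
  by rewrite subnn subSnn /toephank /= !binS !natrD; ring.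
rewrite lhs IHj ?(ltnW lejN) //.
have rhs : \sum_(m < j.+2) 'C(N.+1 - m, j.+1 - m)%:R * x ^+ m +
    \sum_(m < j.+1) 'C(N.+1 - m, j - m)%:R * x ^+ m =
    x * (\sum_(m < j.+1) 'C(N.+1 - m, j - m)%:R * x ^+ m) + 'C(N.+2, j.+1)%:R.
  transitivity (\sum_(m < j.+2) 'C(N.+2 - m, j.+1 - m)%:R * x ^+ m).
    rewrite [in LHS]big_ord_recr [RHS]big_ord_recr /= subnn !bin0 addrAC -big_split.
    congr (_ + _); apply: eq_bigr => m _ /=.
    have lemj : (m <= j)%N by rewrite -ltnS.
    have lemN : (m <= N.+1)%N by rewrite (leq_trans lemj) // ltnW.
    by rewrite (subSn lemj) (subSn lemN) binS natrD mulrDl.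
  rewrite big_ord_recl !subn0 mulr1 addrC mulr_sumr; congr (_ + _).
  by apply: eq_bigr => m _; rewrite /= /bump /= add1n !subSS exprS mulrCA.
by rewrite (canRL (addrK _) rhs); ring.
Qed.

Lemma hankel_entry_binsum i j :
  hankel_entry (i + j) =
  binsum (2 * i).+1 i (fun k => binsum (2 * j).+1 j (toephank (geo_coef 'X) k)).
Proof.
rewrite binsum_toephank binsum_geo_coef; last by lia.
by apply: eq_bigr => m _; congr ('C(_ - _, _)%:R * _); lia.
Qed.

(** * Unitriangular congruence to the Gram determinant *)

Lemma det_unitrig_congr {R : comNzRingType} n (L : 'M[R]_n) (A : 'M[R]_n) :
  is_trig_mx L -> (forall i, L i i = 1) -> \det (L *m A *m L^T) = \det A.
Proof.
move=> trigL diagL; rewrite !det_mulmx det_tr det_trig //.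
by rewrite big1 ?mul1r ?mulr1 // => i _; apply: diagL.
Qed.

Definition binom_mx (R : comNzRingType) n : 'M[R]_n :=
  \matrix_(i, j) if (j <= i)%N then 'C((2 * i).+1, (i - j)%N)%:R else 0.

Lemma binom_mxE {R : comNzRingType} {n} (i : 'I_n) (f : nat -> R) :
  \sum_(k < n) binom_mx R n i k * f k = binsum (2 * i).+1 i f.
Proof.
transitivity (\sum_(k < n | (k < i.+1)%N) 'C((2 * i).+1, (i - k)%N)%:R * f k).
  rewrite [RHS]big_mkcond; apply: eq_bigr => k _.
  by rewrite mxE ltnS; case: ifP => // _; rewrite mul0r.
rewrite (big_ord_narrow (ltn_ord i)) /= (reindex_inj rev_ord_inj) /=.
by apply: eq_bigr => m _; rewrite subSS subKn // -ltnS.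
Qed.

Lemma H0_toephank n :
  H0 n = \det (\matrix_(k < n.+1, l < n.+1) toephank (geo_coef 'X) k l : 'M[{poly rat}]_n.+1).
Proof.
rewrite -(@det_unitrig_congr _ _ (binom_mx _ n.+1)); first last.
- by move=> i; rewrite mxE leqnn subnn bin0.
- by apply/is_trig_mxP => i j ltij; rewrite mxE leqNgt ltij.
congr (\det _); apply/matrixP => i j; rewrite mxE hankel_entry_binsum.
rewrite mxE -(binom_mxE i).
under eq_bigr => k _ do rewrite -(binom_mxE j) mulr_sumr.
rewrite exchange_big /=; apply: eq_bigr => l _; rewrite !mxE mulr_suml.
by apply: eq_bigr => k _; rewrite !mxE; ring.
Qed.

(** * Reduction to a pentadiagonal determinant *)

Definition shear {R : comNzRingType} (q : R) (f : nat -> R) (i : nat) : R :=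
  f i - q * (if i is p.+1 then f p else 0).

Definition shear_mx {R : comNzRingType} (q : R) n : 'M[R]_n :=
  \matrix_(i, j) ((i == j :> nat)%:R - q * (i == j.+1 :> nat)%:R).

Lemma shear_mxE {R : comNzRingType} (q : R) {n} (i : 'I_n) (f : nat -> R) :
  \sum_(k < n) shear_mx q n i k * f k = shear q f i.
Proof.
have pick1 (j : 'I_n) : \sum_(k < n) (j == k :> nat)%:R * f k = f j.
  rewrite (bigD1 j) //= eqxx mul1r big1 ?addr0 // => k kj.
  by rewrite -val_eqE eq_sym in kj; rewrite (negPf kj) mul0r.
under eq_bigr do rewrite mxE mulrBl -mulrA.
rewrite sumrB pick1 -mulr_sumr /shear; congr (_ - _ * _).
case: i => [[|i] ltin] /=; first by rewrite big1 // => k _; rewrite mul0r.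
by under eq_bigr do rewrite eqSS; rewrite (pick1 (Ordinal (ltnW ltin))).
Qed.

Lemma det_shear {R : comNzRingType} (q : R) n (A : nat -> nat -> R) :
  \det (\matrix_(i < n, j < n) shear q (fun k => shear q (A k) j) i) =
  \det (\matrix_(i < n, j < n) A i j).
Proof.
rewrite -[RHS](@det_unitrig_congr _ _ (shear_mx q n)); first last.
- by move=> i; rewrite mxE eqxx ltn_eqF // mulr0 subr0.
- apply/is_trig_mxP => i j ltij; rewrite mxE.
  by rewrite !ltn_eqF ?mulr0 ?subr0 // ltnS ltnW.
congr (\det _); apply/matrixP => i j; rewrite mxE mxE -(shear_mxE _ i).
under eq_bigr => k _ do rewrite -(shear_mxE _ j) mulr_sumr.
rewrite exchange_big /=; apply: eq_bigr => l _; rewrite !mxE mulr_suml.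
by apply: eq_bigr => k _; rewrite !mxE; ring.
Qed.

Definition penta {R : comNzRingType} (x : R) (i j : nat) : R :=
  match i with
  | 0 => [:: 1; 2; 1]`_j
  | 1 => [:: 2; 3 - 3 * x; 2 - x; 1]`_j
  | p.+2 => if (j < p)%N then 0 else [:: 1; 2 - x; 2 - 2 * x; 2 - x; 1]`_(j - p)
  end.

Lemma toeplitz_shear {R : comNzRingType} (x : R) d :
  (1 + (x - 1) ^+ 2) * geo_coef x d -
  (x - 1) * (geo_coef x d.+1 + geo_coef x ((d - 1) + (1 - d))%N) =
  [:: 2 - 2 * x; 2 - x; 1]`_d.
Proof.
case: d => [|[|[|d]]]; rewrite /= ?nth_nil ?subSS ?subn0 ?subn1 ?addn0 /= ?addn0 ?exprS; ring.
Qed.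

(** Shearing rows and columns annihilates the geometric tail of the Hankel part. Away from the first
    row and column only the entry (1, 1) keeps a correction. *)
Lemma hankel_shear {R : comNzRingType} (x : R) m :
  geo_coef x m.+3 - 2 * (x - 1) * geo_coef x m.+2 + (x - 1) ^+ 2 * geo_coef x m.+1 =
  (1 - x) * (m == 0%N)%:R.
Proof. by case: m => [|m] /=; rewrite ?exprS; ring. Qed.

Lemma toephank_sym {R : comNzRingType} (v : nat -> R) k l : toephank v k l = toephank v l k.
Proof. by rewrite /toephank addnC [(k + l)%N]addnC. Qed.

Lemma penta_sym {R : comNzRingType} (x : R) i j : penta x i j = penta x j i.
Proof.
wlog leij : i j / (i <= j)%N => [wl|].
  by case: (leqP i j) => [|/ltnW] /wl.
rewrite -(subnK leij); move: (j - i)%N => d {leij j}.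
case: i => [|[|i]].
- by rewrite addn0; case: d => [|[|[|d]]] //=; rewrite ?subn0 ?nth_nil.
- by rewrite addn1; case: d => [|[|[|d]]] //=; rewrite ?subSS ?subn0 ?nth_nil.
rewrite !addnS /= ltnNge (leq_trans (leq_addl d i)) ?leqW //= subnDA.
case: d => [|[|[|d]]].
- by rewrite add0n ltnNge leqW // leqW //= subn0.
- by rewrite add1n ltnNge leqnSn (addnK i 3%N) subn1 (addnK i 1%N).
- by rewrite add2n ltnn (addnK i 4%N) subn2 subnn.
rewrite (_ : (d.+3 + i).+2 = d.+1 + 4 + i)%N ?addnK; last by rewrite addSn; lia.
by rewrite !addSn !ltnS leq_addl nth_default // addnC.
Qed.

Lemma toephank_shear {R : comNzRingType} (x : R) i j :
  shear (x - 1) (fun k => shear (x - 1) (toephank (geo_coef x) k) j) i = penta x i j.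
Proof.
wlog leij : i j / (i <= j)%N => [wl|].
  case: (leqP i j) => [/wl //|/ltnW/wl wlij].
  rewrite penta_sym -wlij /shear; case: i j {wlij} => [|i] [|j] //.
  - by rewrite [toephank _ 0 _]toephank_sym [toephank _ 0 _]toephank_sym; ring.
  - by rewrite [toephank _ _ 0]toephank_sym [toephank _ _ 0]toephank_sym; ring.
  by rewrite ![toephank _ j.+1 _]toephank_sym ![toephank _ j _]toephank_sym; ring.
case: i leij => [_|i].
  rewrite /shear mulr0 subr0; case: j => [|j] /=.
    by rewrite /toephank /=; ring.
  rewrite toephank_geo_coef0_rec; case: j => [|[|j]] /=; rewrite ?nth_nil; ring.
case: j => // j; rewrite ltnS => leij; rewrite -(subnK leij).
move: (j - i)%N => d {leij j}.
(* Past the first row and column, an entry is a Toeplitz term in the distance [d] from the diagonal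
   plus the Hankel correction at (1, 1). *)
have -> : penta x i.+1 (d + i).+1 =
    [:: 2 - 2 * x; 2 - x; 1]`_d + (1 - x) * ((d + i + i)%N == 0%N)%:R.
  case: i => [|i].
    by rewrite !addn0; case: d => [|[|[|d]]] /=; rewrite ?nth_nil; ring.
  rewrite !addnS /= mulr0 addr0 ltnNge (leq_trans (leq_addl d i)) ?leqW //=.
  by rewrite (addnK i d.+2).
have T := toeplitz_shear x d; have K := hankel_shear x (d + i + i).
have e1 : (i.+1 - (d + i) = 1 - d)%N := subnDr i 1 d.
have e2 : (d + i - i.+1 = d - 1)%N := subnDr i d 1.
have e3 : (i - (d + i) = 0)%N by rewrite addnC subnDA subnn.
have e4 : (i - (d + i).+1 = 0)%N by rewrite -addSn addnC subnDA subnn.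
have e5 : ((d + i).+1 - i = d.+1)%N := addnK i d.+1.
rewrite -T -K /shear /toephank !subSS e1 e2 e3 e4 e5 addnK !add0n [(1 - d + _)%N]addnC.
rewrite !addSn !addnS [(i + (d + i))%N]addnC; ring.
Qed.

Lemma H0_penta n : H0 n = \det (\matrix_(i < n.+1, j < n.+1) penta 'X i j).
Proof.
rewrite H0_toephank -(det_shear ('X - 1) n.+1 (toephank (geo_coef 'X))); congr (\det _).
by apply/matrixP => i j; rewrite !mxE toephank_shear.
Qed.

(** * Kernel vector, Cramer's rule and the closed form *)

(* The solution of the five-term recurrence satisfying the two boundary rows of
   penta at the top and vanishing at n + 1. *)
Definition penta_ker {R : comNzRingType} (x : R) (n j : nat) : R :=
  (-1) ^+ j * (2 - x + 2 * x * j%:R) * cheb x n.+1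
  + (-1) ^+ n * (2 + x + 2 * x * n%:R) * cheb x j.

Lemma penta_ker_last {R : comNzRingType} (x : R) n :
  penta_ker x n.+1 n.+1 = (-1) ^+ n.+1 * chebG x n.
Proof. rewrite /penta_ker /chebG [_ ^+ n.+1]exprS -(natr1 n); ring. Qed.

Lemma penta_ker_zero {R : comNzRingType} (x : R) n : penta_ker x n n.+1 = 0.
Proof. rewrite /penta_ker exprS -(natr1 n); ring. Qed.

Lemma penta_ker_next {R : comNzRingType} (x : R) n :
  penta_ker x n n.+2 = (-1) ^+ n * chebG x n.
Proof. rewrite /penta_ker /chebG !exprS -(natr1 n.+1) -(natr1 n); ring. Qed.

Lemma penta_ker_bulk {R : comNzRingType} (x : R) n p :
  let k := penta_ker x n in
  k p + (2 - x) * k p.+1 + (2 - 2 * x) * k p.+2 + (2 - x) * k p.+3 + k p.+4 = 0.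
Proof.
rewrite /= /penta_ker !chebSS !exprS -(natr1 p.+3) -(natr1 p.+2) -(natr1 p.+1) -(natr1 p); ring.
Qed.

(** The untruncated rows annihilate the kernel vector. Truncation drops columns n + 1, where the
    vector vanishes, and n + 2, which only row [n] reaches, with coefficient 1. *)
Lemma penta_mul_ker {R : comNzRingType} (x : R) n i : (i <= n)%N ->
  \sum_(j < n.+1) penta x i j * penta_ker x n j = - ((-1) ^+ n * chebG x n) * (i == n)%:R.
Proof.
move=> lein.
suff full : \sum_(0 <= j < n.+3) penta x i j * penta_ker x n j = 0.
  rewrite -penta_ker_next -(big_mkord xpredT (fun j => penta x i j * penta_ker x n j)).
  move: full; rewrite !big_nat_recr //= penta_ker_zero mulr0 addr0.
  have -> : penta x i n.+2 = (i == n)%:R.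
    case: i lein => [|[|i]] /=.
    - by case: n => [|n] _ //=; rewrite nth_nil.
    - by case: n => [|[|n]] //= _; rewrite nth_nil.
    move=> ltin; rewrite ltnNge 2?leqW //= 2?ltnW //.
    have -> : (n.+2 - i = (n - i.+2).+4)%N by lia.
    rewrite eqn_leq ltin -subn_eq0 /=; case: (n - _)%N => //= d.
    by rewrite nth_nil.
  by move/(canRL (addrK _)); rewrite sub0r => ->; ring.
case: i lein => [|[|p]] lein.
- rewrite big_nat_recl // big_nat_recl // big_nat_recl //.
  rewrite big1 => [|j _]; last by rewrite /= nth_nil mul0r.
  rewrite /penta_ker /= !exprS; ring.
- case: n lein => // n _.
  rewrite big_nat_recl // big_nat_recl // big_nat_recl // big_nat_recl //.
  rewrite big1 => [|j _]; last first.
    by rewrite /= nth_nil mul0r.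
  rewrite /penta_ker /= !exprS; ring.
(* Row p + 2 is supported on columns p to p + 4. *)
rewrite (@big_cat_nat _ _ _ p) ?(leq_trans _ lein) //=; last by lia.
rewrite [X in X + _]big_nat_cond [X in X + _]big1 => [|j /andP[/andP[_ ltjp] _]]; last first.
  by rewrite ltjp mul0r.
rewrite (@big_cat_nat _ _ _ (p + 5)) ?leq_addr //=; last by lia.
rewrite [X in _ + (_ + X)]big_nat_cond.
rewrite [X in _ + (_ + X)]big1 => [|j /andP[/andP[lepj _] _]]; last first.
  rewrite nth_default ?leq_subRL ?(leq_trans _ lepj) ?leq_addr //.
  by case: ifP; rewrite mul0r.
rewrite add0r addr0 -{1}(add0n p) [(p + 5)%N]addnC big_addn addnK.
rewrite unlock /= !ltnNge !leq_addl /= !addnK.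
by rewrite -[RHS](penta_ker_bulk x n p) !mul1r addr0 !addrA.
Qed.

(** Apply the adjugate and read the last coordinate: its corner entry is the leading principal
    minor. *)
Lemma cramer_last {R : comNzRingType} n (A : 'M[R]_n.+1) (k : 'cV[R]_n.+1) d :
  A *m k = d *: delta_mx ord_max 0 ->
  k ord_max 0 * \det A =
  d * \det (\matrix_(i < n, j < n)
              A (widen_ord (leqnSn n) i) (widen_ord (leqnSn n) j)).
Proof.
move=> Ak; have := congr1 (fun v : 'cV_n.+1 => (\adj A *m v) ord_max 0) Ak.
rewrite mulmxA mul_adj_mx mul_scalar_mx -scalemxAr !mxE mulrC => ->; congr (_ * _).
rewrite (bigD1 ord_max) //= big1 ?addr0 => [|j /negPf nj]; last first.
  by rewrite !mxE nj mulr0.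
rewrite !mxE !eqxx mulr1 /cofactor /= -signr_odd oddD addbb mul1r.
congr (\det _); apply/matrixP => i j; rewrite !mxE; congr (A _ _); apply: val_inj => /=;
  by rewrite /bump leqNgt ltn_ord.
Qed.

Lemma horner_cheb m : (cheb 'X m.+1 : {poly rat}).[2] = m%:R.
Proof.
have [] // : (cheb 'X m.+1 : {poly rat}).[2] = m%:R /\
    (cheb 'X m.+2 : {poly rat}).[2] = m.+1%:R.
elim: m => [|m [IH1 IH2]]; first by rewrite /= !hornerE; split => //; ring.
split=> //; rewrite chebSS hornerD hornerN hornerM hornerX IH1 IH2.
by rewrite -(natr1 m.+1) -(natr1 m); ring.
Qed.

(** At x = 2 the Chebyshev values are n + 1 and n, so the value is a positive integer. *)
Lemma chebG_neq0 n : chebG 'X n != 0 :> {poly rat}.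
Proof.
have ev : (chebG 'X n).[2] = (8 * (n * n) + 16 * n + 4)%N%:R :> rat.
  rewrite /chebG; move: (horner_cheb n.+1) (horner_cheb n).
  move: (cheb _ _) (cheb _ _) => a b ea eb.
  by rewrite -!polyC_natr -polyC1 !(hornerD, hornerM, hornerX, hornerC) ea eb; ring.
by apply/eqP => e; move/eqP: ev; rewrite e horner0 eq_sym Num.Theory.pnatr_eq0 addnS.
Qed.

(** Writing G_n for [chebG 'X n], Cramer's rule at size n + 2 gives G_n H_0(n+1) = - G_(n+1) H_0(n),
    and G_n can be cancelled. *)
Lemma H0_closed n : ('X + 2) * H0 n = (-1) ^+ n * chebG 'X n.
Proof.
elim: n => [|n IHn].
  by rewrite H0_penta det_mx11 mxE /chebG /=; ring.
pose A : 'M[{poly rat}]_n.+2 := \matrix_(i, j) penta 'X i j.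
have detA : \det A = H0 n.+1 by rewrite H0_penta.
have cr : A *m (\col_j penta_ker 'X n.+1 j) =
    (- ((-1) ^+ n.+1 * chebG 'X n.+1)) *: delta_mx ord_max 0.
  apply/matrixP => i j; rewrite !mxE (ord1 j) eqxx andbT.
  rewrite -[i == _]/((i : nat) == n.+1) -penta_mul_ker -1?ltnS //.
  by apply: eq_bigr => l _; rewrite !mxE.
have /cramer_last := cr; rewrite detA mxE penta_ker_last.
rewrite (_ : \det _ = H0 n) => [e|]; last first.
  by rewrite H0_penta; congr (\det _); apply/matrixP => i j; rewrite !mxE.
apply: (mulfI (chebG_neq0 n)); apply: (@lreg_sign _ n.+1).
transitivity (('X + 2) * ((-1) ^+ n.+1 * chebG 'X n * H0 n.+1)); first by ring.
rewrite e; transitivity (- ((-1) ^+ n.+1 * chebG 'X n.+1) * (('X + 2) * H0 n)); first by ring.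
by rewrite IHn !exprS; ring.
Qed.

(** * The differential equation *)

Lemma deriv_cheb n :
  let a := cheb 'X n.+2 : {poly rat} in let b := cheb 'X n.+1 in
  ('X ^+ 2 - 4) * a^`() = n%:R * 'X * a - 2 * (n%:R + 1) * b /\
  ('X ^+ 2 - 4) * b^`() = 2 * n%:R * a - (n%:R + 1) * 'X * b.
Proof.
elim: n => [|n [IHa IHb]].
  by rewrite /= mulr0 sub0r opprK -polyC1 derivC deriv0 polyC1; split; ring.
move=> a1 b1; rewrite {}/a1 {}/b1 [cheb _ n.+3]chebSS.
move: IHa IHb; set a := cheb _ n.+2; set b := cheb _ n.+1 => IHa IHb.
rewrite -(natr1 n) derivB derivM derivX; split; last by rewrite IHa; ring.
transitivity (('X ^+ 2 - 4) * a + 'X * (('X ^+ 2 - 4) * a^`())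
  - ('X ^+ 2 - 4) * b^`()); first by ring.
by rewrite IHa IHb; ring.
Qed.

(** Derivatives become free ring elements tied only by the differentiated relations, which makes the
    elimination a [ring] identity. The factor W^2 (x + 2)^3 clears the denominators of the second
    derivatives. *)
Lemma H0_ode_algebra {R : comNzRingType} (x n s a a1 a2 b b1 b2 h h1 h2 : R) :
  let P := (2 * n + 1) * x + 2 in let P1 := 2 * n + 1 in
  let Q := (2 * n + 3) * x + 2 in let Q1 := 2 * n + 3 in
  let W := x ^+ 2 - 4 in
  W * a1 = n * x * a - 2 * (n + 1) * b ->
  W * b1 = 2 * n * a - (n + 1) * x * b ->
  2 * x * a1 + W * a2 = n * a + n * x * a1 - 2 * (n + 1) * b1 ->
  2 * x * b1 + W * b2 = 2 * n * a1 - (n + 1) * b - (n + 1) * x * b1 ->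
  (x + 2) * h = s * (P * a + Q * b) ->
  h + (x + 2) * h1 = s * (P1 * a + P * a1 + Q1 * b + Q * b1) ->
  2 * h1 + (x + 2) * h2 =
    s * (2 * P1 * a1 + P * a2 + 2 * Q1 * b1 + Q * b2) ->
  W ^+ 2 * (x + 2) ^+ 3 *
  ((x - 2) * (x + 2)
   * (4 * n ^+ 2 * x ^+ 2 + 4 * n * x ^+ 2 + x ^+ 2 + 8 * n * x + 4) * h2 +
   2 * (4 * n ^+ 2 * x ^+ 3 + 4 * n * x ^+ 3 + x ^+ 3 - 4 * n ^+ 2 * x ^+ 2
       + 8 * n * x ^+ 2 - x ^+ 2 + 16 * n ^+ 2 * x + 8 * n * x + 12 * x
       + 16 * n - 4) * h1 +
   - n * (n + 1)
   * (4 * n ^+ 2 * x ^+ 2 + 4 * n * x ^+ 2 + x ^+ 2 + 8 * n * x - 8 * x + 36) * h) = 0.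
Proof.
move=> P P1 Q Q1 W ea eb ea2 eb2 e0 e1 e2.
set T2 := (X in X * h2); set T1 := (X in X * h1); set T0 := (X in X * h).
have {}ea2 : W ^+ 2 * a2 =
    W * n * a + (n - 2) * x * (n * x * a - 2 * (n + 1) * b)
    - 2 * (n + 1) * (2 * n * a - (n + 1) * x * b).
  rewrite -ea -eb expr2 -mulrA (canRL (addKr _) ea2); ring.
have {}eb2 : W ^+ 2 * b2 =
    2 * n * (n * x * a - 2 * (n + 1) * b) - W * (n + 1) * b
    - (n + 3) * x * (2 * n * a - (n + 1) * x * b).
  rewrite -ea -eb expr2 -mulrA (canRL (addKr _) eb2); ring.
(* With F = (x + 2) h, these solve the triangular system that turns (x + 2)^3 (T2 h'' + T1 h' + T0
   h) into c2 F'' + c1 F' + c0 F. *)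
pose c2 := (x + 2) ^+ 2 * T2.
pose c1 := (x + 2) * ((x + 2) * T1 - 2 * T2).
pose c0 := (x + 2) ^+ 2 * T0 - ((x + 2) * T1 - 2 * T2).
transitivity (W ^+ 2 * (c2 * (2 * h1 + (x + 2) * h2) + c1 * (h + (x + 2) * h1)
    + c0 * ((x + 2) * h))).
  by rewrite /c2 /c1 /c0; ring.
rewrite e0 e1 e2.
transitivity (s * (
    c2 * (2 * P1 * W * (W * a1) + P * (W ^+ 2 * a2)
          + 2 * Q1 * W * (W * b1) + Q * (W ^+ 2 * b2))
    + c1 * W * (W * (P1 * a + Q1 * b) + P * (W * a1) + Q * (W * b1))
    + c0 * W ^+ 2 * (P * a + Q * b))); first by ring.
rewrite ea2 eb2 ea eb /c2 /c1 /c0 /T2 /T1 /T0 /P /P1 /Q /Q1 /W; ring.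
Qed.

Theorem theorem2 (n : nat) :
  S2 n * (H0 n)^`(2) + S1 n * (H0 n)^`() + S0 n * H0 n = 0.
Proof.
have [ea eb] := deriv_cheb n; have e0 := H0_closed n; rewrite /chebG in e0.
move: ea eb e0; move: (cheb _ n.+2) (cheb _ n.+1) => a b ea eb e0.
(* As a constant polynomial, the sign is differentiated by [derivC]. *)
have [c sE] : exists c : rat, (-1) ^+ n = c%:P by exists ((-1) ^+ n); rewrite rmorphXn rmorphN1.
rewrite sE in e0.
(* Comparing differences of sides lets [ring] absorb the shape in which the differentiated relations
   come out. *)
have eq_by (p q p' q' : {poly rat}) : p' = q' -> p - q = p' - q' -> p = q.
  by move=> ->; rewrite subrr => /subr0_eq.
have ea2 := congr1 deriv ea; have eb2 := congr1 deriv eb.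
have e1 := congr1 deriv e0; have e2 := congr1 deriv e1.
rewrite -!polyC_natr -polyC1 !(derivD, derivN, derivM, derivX, derivXn, derivC, deriv0)
  in ea2 eb2 e1 e2.
rewrite !polyC_natr polyC1 in ea2 eb2 e1 e2.
have nzXD (d : rat) : 'X + d%:P != 0 by rewrite -size_poly_eq0 size_XaddC.
have nzD : 'X + 2 != 0 :> {poly rat} by rewrite -polyC_natr nzXD.
have nzB : 'X - 2 != 0 :> {poly rat} by rewrite -polyC_natr -polyCN nzXD.
have nzW : ('X ^+ 2 - 4) ^+ 2 * ('X + 2) ^+ 3 != 0 :> {poly rat}.
  rewrite (_ : 'X ^+ 2 - 4 = ('X - 2) * ('X + 2)); last by ring.
  by rewrite !mulf_neq0 ?expf_neq0 ?mulf_neq0.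
apply: (mulfI nzW); rewrite mulr0.
apply: (H0_ode_algebra 'X n%:R c%:P a a^`() a^`()^`() b b^`() b^`()^`()) => //.
- by apply: (eq_by _ _ _ _ ea2); ring.
- by apply: (eq_by _ _ _ _ eb2); ring.
- by apply: (eq_by _ _ _ _ e1); ring.
- by apply: (eq_by _ _ _ _ e2); rewrite !derivnS ?derivn0; ring.
Qed.
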